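(* Let $r > 1$ and $k \geq 1$ be integers with $W(r,k) > \max(\{r,k\})$, and let $n$ be the exponent of the leading power of $r$ in the base-$r$ expansion of $W(r,k)$. Then $$n > \frac{\log W(r,k)}{\log r} - 1.$$
   Context: For positive integers $r, k$, the van der Waerden number $W(r,k)$ is the least positive integer $N$ such that every coloring of the integer interval $[1,N]=\{1,\dots,N\}$ with $r$ colors contains a monochromatic arithmetic progression of $k$ terms. For $W(r,k) > r > 1$, write the base-$r$ expansion $W(r,k) = b_{n}r^{n} + b_{n-1}r^{n-1} + \cdots + b_{0}$ with integers $1 \leq b_n \leq r-1$ and $0 \leq b_i \leq r-1$ for $i<n$; the exponent of the leading power is this $n$, equivalently the unique integer with $r^{n} \leq W(r,k) < r^{n+1}$. *)

(* Defs.v *)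
From mathcomp Require Import all_boot zify boolp.

Set Implicit Arguments.
Unset Strict Implicit.
Unset Printing Implicit Defensive.

(* A colouring of [1, N] is represented by a colouring of nat, of which only
   the values on [1, N] are used. *)
Definition vdW_property (r k N : nat) : Prop :=
  forall c : nat -> 'I_r,
  exists (a d : nat) (x : 'I_r),
    0 < d /\ forall i, i < k -> 1 <= a + i * d <= N /\ c (a + i * d) = x.

(* The following lemmas prove van der Waerden's theorem by colour focusing:
   [vdW_focus] gives either a monochromatic progression of k.+1 terms, or s
   progressions of k terms with distinct colours (the elements of S) and the
   same next term f. The bounds on d make the case k = 0 uniform. *)
Definition vdW_bounded (k : nat) : Prop :=
  forall C : finType, exists N, forall c : nat -> C, exists a d,
    [/\ 0 < d, d < N, a + k * d < N & forall i, i < k -> c (a + i * d) = c a].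

Lemma vdW_focus k (C : finType) : vdW_bounded k -> forall s, exists N,
  forall c : nat -> C,
    (exists a d, [/\ 0 < d, d < N, a + k * d < N &
       forall i, i < k.+1 -> c (a + i * d) = c a])
    \/ (exists (S : {set C}) f, [/\ #|S| = s, f < N & forall x, x \in S ->
       exists a d, [/\ 0 < d, d < N, a + k * d = f &
         forall i, i < k -> c (a + i * d) = x]]).
Proof.
move=> Pk; elim=> [|s [N IH]].
  exists 1 => c; right; exists set0, 0; split=> //; first by rewrite cards0.
  by move=> x; rewrite inE.
have [M HM] := Pk {ffun 'I_N -> C}; exists (M + N + M) => c.
pose c' b := [ffun i : 'I_N => c (b + i)] : {ffun 'I_N -> C}.
have [a [d [d0 dM aM Hblock]]] := HM c'.
have Hb i p : i < k -> p < N -> c (a + i * d + p) = c (a + p).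
  move=> ik pN; have := congr1 (fun g : {ffun 'I_N -> C} => g (Ordinal pN))
    (Hblock i ik).
  by rewrite !ffunE.
have [[a1 [d1 [d10 b1 b2 H1]]]|[S [f [cS fN HS]]]] := IH (fun x => c (a + x)).
  left; exists (a + a1), d1; split=> //; [lia | lia |].
  by move=> i ik; rewrite -!addnA H1.
have [cfS|cfS] := boolP (c (a + f) \in S).
  have [a1 [d1 [d10 d1N ef Hc]]] := HS _ cfS; left.
  have Hx i : i < k.+1 -> c (a + a1 + i * d1) = c (a + f).
    rewrite ltnS leq_eqVlt => /orP[/eqP->|ik]; first by rewrite -addnA ef.
    by rewrite -addnA Hc.
  exists (a + a1), d1; split=> //; [lia | lia |].
  by move=> i ik; rewrite Hx // -(Hx 0) // mul0n addn0.
right; exists (c (a + f) |: S), (a + f + k * d); split; first 1 last.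
- by lia.
- move=> x /setU1P[->|xS].
    exists (a + f), d; split=> //; first by lia.
    by move=> i ik; rewrite addnAC Hb.
  have [a1 [d1 [d10 d1N ef Hc]]] := HS _ xS.
  exists (a + a1), (d + d1); split; [lia | lia | lia |] => i ik.
  have -> : a + a1 + i * (d + d1) = a + i * d + (a1 + i * d1) by lia.
  by rewrite Hb ?Hc //; nia.
- by rewrite cardsU1 cfS cS.
Qed.

Lemma vdW_boundedP k : vdW_bounded k.
Proof.
elim: k => [|k IH] C; first by exists 2 => c; exists 0, 1.
have [N HN] := vdW_focus C IH #|C|; exists (N + N) => c.
have [[a [d [d0 dN aN H]]]|[S [f [cS fN HS]]]] := HN c.
  by exists a, d; split=> //; lia.
have /HS[a [d [d0 dN ef Hc]]] : c f \in S.
  by have /eqP-> : S == setT by rewrite eqEcard subsetT cardsT cS /=.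
have Hx i : i < k.+1 -> c (a + i * d) = c f.
  by rewrite ltnS leq_eqVlt => /orP[/eqP->|ik]; rewrite ?ef ?Hc.
exists a, d; split=> //; [lia | lia |].
by move=> i ik; rewrite Hx // -(Hx 0) // mul0n addn0.
Qed.

Theorem van_der_Waerden (r k : nat) :
  exists N, (0 < N) && `[< vdW_property r k N >].
Proof.
have [N HN] := vdW_boundedP k 'I_r.
exists N.+1; apply/asboolP => c.
have [a [d [d0 dN aN H]]] := HN (fun i => c i.+1).
exists a.+1, d, (c a.+1); split=> // i ik; rewrite addSn H //; split=> //.
by rewrite ltnS /=; nia.
Qed.

Definition vdW (r k : nat) : nat := ex_minn (van_der_Waerden r k).

(* N = b_n r^n + ... + b_0 in base r, with nonzero leading digit b_n. *)
Definition base_expansion (r N n : nat) (b : nat -> nat) : Prop :=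
  [/\ N = \sum_(i < n.+1) b i * r ^ i,
      1 <= b n <= r - 1 &
      forall i, i < n -> b i <= r - 1].

Definition leading_exponent (r N n : nat) : Prop :=
  exists b, base_expansion r N n b.

(* Main.v *)
Require Import Defs.
From mathcomp Require Import all_boot all_order all_algebra reals exp.

(** Digits at most [r - 1] in positions [0..n] sum to at most (r-1)(1 + r + ... + r^n) = r^(n+1) -
    1, so W < r^(n+1) ([base_expansion_lt], from [digit_sum_lt]). Taking logarithms, ln W < (n+1) ln
    r, and dividing by ln r > 0 gives the bound. *)

Lemma digit_sum_lt (r m : nat) (b : nat -> nat) :
  (0 < r)%N -> (forall i, (i < m)%N -> (b i <= r - 1)%N) ->
  (\sum_(i < m) b i * r ^ i < r ^ m)%N.
Proof.
move=> r0; elim: m => [|m IH] hb; first by rewrite big_ord0.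
rewrite big_ord_recr /= expnS.
have lt_m : (\sum_(i < m) b i * r ^ i < r ^ m)%N.
  by apply: IH => i im; apply: hb; apply: ltnW.
(* The lower digits stay strictly below [r ^ m], and the intermediate bound is exactly
   [r * r ^ m]. *)
apply: (@leq_trans (r ^ m + (r - 1) * r ^ m)%N).
  by rewrite -addSn leq_add // leq_mul2r hb // orbT.
by rewrite -mulSn subn1 prednK.
Qed.

Lemma base_expansion_lt (r N n : nat) (b : nat -> nat) :
  (0 < r)%N -> base_expansion r N n b -> (N < r ^ n.+1)%N.
Proof.
move=> r0 [-> /andP[_ bn] hb]; apply: digit_sum_lt => // i.
by rewrite ltnS leq_eqVlt => /predU1P[->|/hb].
Qed.

Import Order.TTheory GRing.Theory Num.Theory.

Theorem corollary2p1 (R : realType) (r k n : nat)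
  (hr : (1 < r)%N) (hk : (1 <= k)%N)
  (hW : (maxn r k < vdW r k)%N)
  (hn : leading_exponent r (vdW r k) n) :
  (n%:R > ln ((vdW r k)%:R : R) / ln (r%:R : R) - 1 :> R)%R.
Proof.
have r0 : (0 < r)%N := ltnW hr.
have [b /(base_expansion_lt _ _ _ _ r0) W_lt] := hn.
have W0 : (0 < vdW r k)%N := leq_ltn_trans (leq0n _) hW.
have lnr0 : (0 < ln (r%:R : R))%R by rewrite ln_gt0 // ltr1n.
(* Clearing the denominator leaves ln W < ln (r^(n+1)), which is [W_lt] because [ln] is increasing
   on positive reals. *)
rewrite ltrBlDr natr1 ltr_pdivrMr // mulr_natl -lnXn ?ltr0n // -natrX.
by rewrite ltr_ln ?posrE ?ltr0n ?expn_gt0 ?r0 // ltr_nat.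
Qed.
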